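(* Let $(H,\mu)$ be a special Hilbertian algebra and let $J=J(H,\mu)$ be its Jacobson radical. Then $H=J\oplus_2 J^{\perp}$ (orthogonal direct sum of Hilbert spaces) and $J^{\perp}$ is a closed subalgebra and a closed subcoalgebra of $(H,\mu)$.
   Context: All Hilbert spaces are complex; $\hat{\otimes}_2$ is the Hilbert space tensor product; $f^{\dagger}$ is the Hilbert adjoint of a bounded linear map $f$. A Hilbertian algebra is a pair $(H,\mu)$ with $H$ a Hilbert space and $\mu\colon H\hat{\otimes}_2H\to H$ a bounded linear map which is associative and commutative (no unit is assumed); write $xy:=\mu(x\otimes y)$. It is special when $\mu\circ\mu^{\dagger}=id_H$. (No Frobenius condition is assumed.) $J(H,\mu)$ is the Jacobson radical of the commutative Banach algebra $H$ with product $(x,y)\mapsto xy$ (and an equivalent submultiplicative norm), i.e. the intersection of its maximal modular ideals, equivalently of the kernels of its non-zero algebra maps to $\mathbb{C}$ (so $J(H,\mu)=H$ if there are none). A subalgebra is a closed subspace $V$ with $\mu(V\hat{\otimes}_2V)\subseteq V$; a subcoalgebra is a closed subspace $V$ with $\mu^{\dagger}(V)\subseteq V\hat{\otimes}_2V$, where $V\hat{\otimes}_2V$ is identified with its image in $H\hat{\otimes}_2H$. *)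

(* Defs.v *)
From HB Require Import structures.
From mathcomp Require Export all_boot all_order all_algebra.
From mathcomp Require Export sesquilinear complex.
From mathcomp Require Export all_classical all_reals all_analysis.

Set Implicit Arguments.
Unset Strict Implicit.
Unset Printing Implicit Defensive.

Import Order.TTheory GRing.Theory Num.Theory.
Import numFieldNormedType.Exports.

Local Open Scope classical_set_scope.
Local Open Scope ring_scope.
Local Open Scope complex_scope.

(* The inner product is linear in its first argument and conjugate-linear in
   the second one; norms of normed R[i]-modules take values in R[i]. *)
Record hilbert (R : realType) := Hilbert {
  hilbert_sort :> completeNormedModType R[i];
  dotp : {dot hilbert_sort for (Num.conj : R[i] -> R[i])};
  dotp_norm : forall x : hilbert_sort, dotp x x = `|x| ^+ 2 }.

Notation "'[< x , y >]" := (dotp _ x y) : ring_scope.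

Section Subspaces.
Context {R : realType}.
Implicit Types H K : hilbert R.

Definition linear_subspace H (V : set H) : Prop :=
  V 0 /\ forall (a : R[i]) (x y : H), V x -> V y -> V (a *: x + y).

Definition closed_subspace H (V : set H) : Prop :=
  linear_subspace V /\ closed V.

Definition closed_span H (A : set H) : set H := smallest (@closed_subspace H) A.

Definition orthocomp H (V : set H) : set H :=
  [set x | forall y, V y -> '[< x, y >] = 0].

(* H is the internal Hilbert direct sum of V and W; uniqueness of the
   decomposition follows from orthogonality. *)
Definition orthogonal_direct_sum H (V W : set H) : Prop :=
  [/\ closed_subspace V, closed_subspace W,
      (forall v w : H, V v -> W w -> '[< v, w >] = 0) &
      forall x : H, exists v w : H, [/\ V v, W w & x = v + w]].

Definition bounded_operator H K (f : H -> K) : Prop :=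
  exists M : R, forall x : H, `|f x| <= M%:C * `|x|.

(* The vector adjoint f y is the z such that <f x, y> = <x, z> for all x; when
   f is bounded linear it exists (Riesz) and is unique, and the default value
   0 of xget is not used. *)
Definition adjoint H K (f : H -> K) (y : K) : H :=
  xget 0 [set z | forall x : H, '[< f x, y >] = '[< x, z >]].

End Subspaces.

(* A Hilbert tensor product of H and K, i.e. a completion of the algebraic
   tensor product for the inner product
   <x (x) y, x' (x) y'> = <x, x'> <y, y'>.
   It is unique up to a unique unitary map compatible with tens. *)
Record hilbert_tensor (R : realType) (H K : hilbert R) := HilbertTensor {
  tensor_space :> hilbert R;
  tens : {bilinear H -> K -> tensor_space};
  dotp_tens : forall (x x' : H) (y y' : K),
    '[< tens x y, tens x' y' >] = '[< x, x' >] * '[< y, y' >];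
  tens_dense :
    closed_span [set z | exists x y, z = tens x y] = [set: tensor_space] }.

Record hilbertian_algebra (R : realType) (H : hilbert R)
    (T : hilbert_tensor H H) := HilbertianAlgebra {
  mu :> {linear T -> H};
  mu_bounded : bounded_operator mu;
  mu_assoc : forall x y z : H,
    mu (tens T (mu (tens T x y)) z) = mu (tens T x (mu (tens T y z)));
  mu_comm : forall x y : H, mu (tens T x y) = mu (tens T y x) }.

Section HilbertianAlgebra.
Context {R : realType} {H : hilbert R} {T : hilbert_tensor H H}.
Variable A : hilbertian_algebra T.

Definition hmul (x y : H) : H := mu A (tens T x y).

Definition special : Prop := forall x : H, mu A (adjoint (mu A) x) = x.

(* Ideals are not assumed to be closed. *)
Definition is_ideal (I : set H) : Prop :=
  linear_subspace I /\ forall x y : H, I y -> I (hmul x y).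

Definition is_modular (I : set H) : Prop :=
  exists u : H, forall x : H, I (x - hmul u x).

Definition maximal_modular_ideal (M : set H) : Prop :=
  [/\ is_ideal M, is_modular M, M <> setT &
      forall I : set H, is_ideal I -> I <> setT -> M `<=` I -> I = M].

(* This is the whole of H when there is no maximal modular ideal. *)
Definition jacobson_radical : set H :=
  \bigcap_(M in maximal_modular_ideal) M.

(* The image of the tensor square of V in that of H. *)
Definition tensor_square (V : set H) : set T :=
  closed_span [set z | exists x y, [/\ V x, V y & z = tens T x y]].

Definition closed_subalgebra (V : set H) : Prop :=
  closed_subspace V /\ forall z : T, tensor_square V z -> V (mu A z).

Definition closed_subcoalgebra (V : set H) : Prop :=
  closed_subspace V /\ forall x : H, V x -> tensor_square V (adjoint (mu A) x).

End HilbertianAlgebra.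

(* Main.v *)
From HB Require Import structures.
Require Import Defs.
From mathcomp Require Import ring lra.

(** Call a nonzero vector [e] a character vector when [x |-> <x, e>] is
    multiplicative with a maximal modular ideal as kernel. The radical is the orthogonal complement of the set of character vectors, so its
    orthogonal complement is their closed span, and both closure properties
    reduce to what [mu] and its adjoint do to character vectors.

    Multiplicativity says exactly that the adjoint of [mu] sends [e] to
    [e (x) e] ([comul_character]), which gives the subcoalgebra part. When
    the algebra is special the adjoint of [mu] is an isometry, hence
    [<e, f> = <e (x) e, f (x) f> = <e, f>^2] for character vectors [e] and [f]:
    each inner product is 0 or 1, so the character vectors are orthonormal
    ([dot_character]). Moreover [e e = mu (mu^dag e) = e]. For [e <> f] the
    product [e f] is an idempotent killed by every character, that is, an
    idempotent of the radical, and such an idempotent vanishes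
    ([radical_idempotent], by Zorn's lemma). So products of character vectors
    are 0 or character vectors, which gives the subalgebra part.

    The analytic content is that every maximal modular ideal [M] is the kernel
    of a character vector ([maximal_modular_character]). In a special algebra
    [|xy| <= |x| |y|], so [M] is closed, by the usual Neumann series argument,
    and the point is that [H / M] is one-dimensional ([gelfand_mazur]). The quotient is represented by the orthogonal complement
    of [M]; if [a] has empty spectrum modulo [M], the resolvent [F] is defined
    on the whole plane. The reciprocal of its norm is 1-Lipschitz and tends to
    infinity, because of the resolvent identity, so the norm of [F] has a
    maximum. Averaging over the four points at [h], [ih], [-h], [-ih] from the
    maximum cancels the terms of order 1 to 3 of the expansion of [F], which
    forces its first derivative [F^2] to vanish modulo [M] there
    ([max_modulus]), although [F] is invertible modulo [M]. *)

Set Implicit Arguments.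
Unset Strict Implicit.
Unset Printing Implicit Defensive.

Import Order.TTheory GRing.Theory Num.Theory.
Import numFieldNormedType.Exports.

Local Open Scope classical_set_scope.
Local Open Scope ring_scope.
Local Open Scope complex_scope.

(** * Real-valued moduli, norms and inner products *)

Section Modulus.
Context {R : realType}.
Local Notation C := R[i].

(** The norm of a numeric field takes its values in that field; moduli and
    norms are read as elements of [R], where the decision procedures for
    ordered fields apply. *)
Definition modulus (a : C) : R := complex.Re `|a|.

Lemma modulusE (a : C) : `|a| = (modulus a)%:C.
Proof. by rewrite /modulus RRe_real // normr_real. Qed.

Lemma modulus_ge0 (a : C) : 0 <= modulus a.
Proof. by rewrite -lecR -modulusE normr_ge0. Qed.

Lemma modulusM (a b : C) : modulus (a * b) = modulus a * modulus b.
Proof. by apply: complexI; rewrite -modulusE normrM !modulusE rmorphM. Qed.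

Lemma modulusX (a : C) n : modulus (a ^+ n) = modulus a ^+ n.
Proof. by apply: complexI; rewrite -modulusE normrX modulusE rmorphXn. Qed.

Lemma modulusN (a : C) : modulus (- a) = modulus a.
Proof. by rewrite /modulus normrN. Qed.

Lemma modulus_eq0 (a : C) : modulus a = 0 -> a = 0.
Proof. by move=> a0; apply/eqP; rewrite -normr_eq0 modulusE a0. Qed.

Lemma modulusD (a b : C) : modulus (a + b) <= modulus a + modulus b.
Proof. by rewrite -lecR rmorphD /= -!modulusE ler_normD. Qed.

Lemma modulusR (t : R) : modulus t%:C = `|t|.
Proof. by rewrite /modulus normc_def /= expr0n addr0 sqrtr_sqr. Qed.

Lemma mulc_conj (a : C) : a * Num.conj a = (modulus a ^+ 2)%:C.
Proof. by rewrite -normCK modulusE rmorphXn. Qed.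

Lemma Re_conj (a : C) : complex.Re (Num.conj a) = complex.Re a.
Proof. by case: a. Qed.

Lemma Re_le_modulus (a : C) : complex.Re a <= modulus a.
Proof.
have := normc_ge_Re a; rewrite modulusE lecR; apply: le_trans; exact: ler_norm.
Qed.

Lemma ReD (a b : C) : complex.Re (a + b) = complex.Re a + complex.Re b.
Proof. by case: a; case: b. Qed.

Lemma ReN (a : C) : complex.Re (- a) = - complex.Re a.
Proof. by case: a. Qed.

Lemma ReZ (t : R) (a : C) : complex.Re (t%:C * a) = t * complex.Re a.
Proof. by case: a => x y /=; rewrite mul0r subr0. Qed.

End Modulus.

Section HilbertNorm.
Context {R : realType}.
Local Notation C := R[i].
Implicit Types H : hilbert R.

Definition hnorm H (x : H) : R := complex.Re `|x|.
Definition rdot H (x y : H) : R := complex.Re '[< x, y >].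

Lemma hnormE H (x : H) : `|x| = (hnorm x)%:C.
Proof. by rewrite /hnorm RRe_real // normr_real. Qed.

Lemma hnorm_ge0 H (x : H) : 0 <= hnorm x.
Proof. by rewrite -lecR -hnormE normr_ge0. Qed.

Lemma hnormZ H (a : C) (x : H) : hnorm (a *: x) = modulus a * hnorm x.
Proof. by apply: complexI; rewrite -hnormE normrZ modulusE hnormE rmorphM. Qed.

Lemma hnorm_eq0 H (x : H) : hnorm x = 0 -> x = 0.
Proof. by move=> x0; apply/eqP; rewrite -normr_eq0 hnormE x0. Qed.

Lemma hnorm0 H : hnorm (0 : H) = 0.
Proof. by rewrite /hnorm normr0. Qed.

Lemma hnormD H (x y : H) : hnorm (x + y) <= hnorm x + hnorm y.
Proof. by rewrite -lecR rmorphD /= -!hnormE ler_normD. Qed.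

Lemma hnormN H (x : H) : hnorm (- x) = hnorm x.
Proof. by rewrite /hnorm normrN. Qed.

Lemma hnormBC H (x y : H) : hnorm (x - y) = hnorm (y - x).
Proof. by rewrite -hnormN opprB. Qed.

Lemma hnormB H (x y : H) : hnorm (x - y) <= hnorm x + hnorm y.
Proof. by rewrite -(hnormN y) hnormD. Qed.

Lemma dotpp H (x : H) : '[< x, x >] = (hnorm x ^+ 2)%:C.
Proof. by rewrite dotp_norm hnormE rmorphXn. Qed.

Lemma hnorm_sqr H (x : H) : hnorm x ^+ 2 = rdot x x.
Proof. by rewrite /rdot dotpp. Qed.

Lemma dotpC H (x y : H) : '[< x, y >] = Num.conj '[< y, x >].
Proof. by rewrite hermC expr0 mul1r. Qed.

Lemma dotpZl H (a : C) (x y : H) : '[< a *: x, y >] = a * '[< x, y >].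
Proof. by rewrite linearZl_LR. Qed.

Lemma dotpZr H (a : C) (x y : H) : '[< x, a *: y >] = Num.conj a * '[< x, y >].
Proof. by rewrite linearZr_LR. Qed.

Lemma dotpPl H (a : C) (x y z : H) :
  '[< a *: x + y, z >] = a * '[< x, z >] + '[< y, z >].
Proof. by rewrite linearDl /= dotpZl. Qed.

Lemma dotpPr H (a : C) (x y z : H) :
  '[< z, a *: x + y >] = Num.conj a * '[< z, x >] + '[< z, y >].
Proof. by rewrite linearDr /= dotpZr. Qed.

Lemma dotpBl H (x y z : H) : '[< x - y, z >] = '[< x, z >] - '[< y, z >].
Proof. exact: linearBl. Qed.

Lemma rdotC H (x y : H) : rdot x y = rdot y x.
Proof. by rewrite /rdot dotpC Re_conj. Qed.

Lemma rdotDr H (x y z : H) : rdot x (y + z) = rdot x y + rdot x z.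
Proof. by rewrite /rdot linearDr ReD. Qed.

Lemma rdotZ H (t : R) (x y : H) : rdot x (t%:C *: y) = t * rdot x y.
Proof. by rewrite rdotC /rdot dotpZl ReZ -/(rdot _ _) rdotC. Qed.

Lemma rdotN H (x y : H) : rdot x (- y) = - rdot x y.
Proof. by rewrite /rdot linearNr ReN. Qed.

Lemma hnorm_sqrD H (x y : H) :
  hnorm (x + y) ^+ 2 = hnorm x ^+ 2 + 2 * rdot x y + hnorm y ^+ 2.
Proof.
rewrite !hnorm_sqr rdotDr [rdot _ x]rdotC [rdot _ y]rdotC !rdotDr (rdotC y x).
by rewrite mulr2n mulrDl mul1r !addrA.
Qed.

Lemma parallelogram H (x y : H) :
  hnorm (x + y) ^+ 2 + hnorm (x - y) ^+ 2 = 2 * (hnorm x ^+ 2 + hnorm y ^+ 2).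
Proof. by rewrite !hnorm_sqrD hnormN rdotN; ring. Qed.

(** Real Cauchy-Schwarz is the triangle inequality squared. *)
Lemma rdot_le H (x y : H) : rdot x y <= hnorm x * hnorm y.
Proof.
have h : hnorm (x + y) ^+ 2 <= (hnorm x + hnorm y) ^+ 2.
  by rewrite lerXn2r ?nnegrE ?addr_ge0 ?hnorm_ge0 ?hnormD.
by move: h; rewrite hnorm_sqrD; nra.
Qed.

(** The real inequality for [x] and [c y], where [c = <x, y>] supplies the
    right phase. *)
Lemma dotp_le H (x y : H) : modulus '[< x, y >] <= hnorm x * hnorm y.
Proof.
set c := '[< x, y >].
have h : modulus c ^+ 2 <= modulus c * (hnorm x * hnorm y).
  have := rdot_le x (c *: y).
  rewrite /rdot dotpZr mulrC mulc_conj /= hnormZ; lra.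
have := modulus_ge0 c; rewrite le_eqVlt => /predU1P[<-|c0].
  by rewrite mulr_ge0 ?hnorm_ge0.
by move: h; rewrite expr2 ler_pM2l.
Qed.

(** Closedness without filters, with real radii. *)
Lemma closed_hnormP H (V : set H) :
  closed V <->
  (forall x,
     (forall e : R, 0 < e -> exists2 y, V y & hnorm (x - y) < e) -> V x).
Proof.
split=> [Vc x h|h x clx].
  apply: Vc => B /nbhs_ballP[e /= e0 eB].
  have e0' : 0 < complex.Re e by move: e0; rewrite ltcE => /andP[].
  have [y Vy xy] := h _ e0'; exists y; split => //; apply: eB.
  rewrite -ball_normE /ball_ /= hnormE (_ : e = (complex.Re e)%:C) ?ltcR //.
  by rewrite RRe_real // gtr0_real.
apply: h => e e0.
have [|y [Vy]] := clx (ball x e%:C).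
  by apply: nbhsx_ballx; rewrite ltcR.
by rewrite -ball_normE /ball_ /= hnormE ltcR; exists y.
Qed.

Lemma hilbert_complete H (u : nat -> H) :
  (forall e : R, 0 < e ->
     exists N, forall n m, (N <= n)%N -> (N <= m)%N -> hnorm (u n - u m) < e) ->
  exists l : H, forall e : R, 0 < e ->
     exists N, forall n, (N <= n)%N -> hnorm (u n - l) < e.
Proof.
move=> cu.
have cc : cauchy (u @ \oo).
  apply/cauchy_ballP => e e0.
  have e0' : 0 < complex.Re e by move: e0; rewrite ltcE => /andP[].
  have [N hN] := cu _ e0'.
  have oo : (u @ \oo) [set x | exists2 n, (N <= n)%N & x = u n].
    by exists N => // n /= Nn; exists n.
  exists ([set x | exists2 n, (N <= n)%N & x = u n],
          [set x | exists2 n, (N <= n)%N & x = u n]); first by split; exact: oo.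
  move=> [x y] /= [[n Nn ->] [m Nm ->]].
  rewrite -ball_normE /ball_ /= hnormE (_ : e = (complex.Re e)%:C) ?ltcR ?hN //.
  by rewrite RRe_real // gtr0_real.
have /cvg_ex[l ul] : cvg (u @ \oo) by apply/cauchy_cvgP.
exists l => e e0.
have e0' : 0 < e%:C by rewrite ltcR.
have [N _ hN] := cvgr_dist_lt u l ul _ e0'.
exists N => n Nn; have := hN n Nn; by rewrite hnormE ltcR hnormBC.
Qed.

End HilbertNorm.

(** * Closed subspaces, orthogonal projection and the Riesz theorem *)

Section Subspace.
Context {R : realType}.
Local Notation C := R[i].
Implicit Types H : hilbert R.

Lemma closed_subspaceW H (V : set H) : closed_subspace V -> linear_subspace V.
Proof. by case. Qed.

Lemma subspace0 H (V : set H) : linear_subspace V -> V 0.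
Proof. by case. Qed.

Lemma subspaceD H (V : set H) x y :
  linear_subspace V -> V x -> V y -> V (x + y).
Proof. by move=> [_ VP] Vx Vy; rewrite -(scale1r x); exact: VP. Qed.

Lemma subspaceZ H (V : set H) (a : C) x :
  linear_subspace V -> V x -> V (a *: x).
Proof. by move=> [V0 VP] Vx; rewrite -(addr0 (a *: x)); exact: VP. Qed.

Lemma subspaceB H (V : set H) x y :
  linear_subspace V -> V x -> V y -> V (x - y).
Proof.
move=> [V0 VP] Vx Vy; rewrite addrC -scaleN1r; exact: VP.
Qed.

End Subspace.

#[local] Hint Extern 0 (linear_subspace _) =>
  solve [apply: closed_subspaceW; eassumption] : core.

Section Projection.
Context {R : realType}.
Local Notation C := R[i].
Implicit Types H : hilbert R.

(** First order condition at the minimum, taken in the direction [<x-v, y> y]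
    to reach the complex inner product from its real part. *)
Lemma min_dist_orthogonal H (V : set H) (x v : H) :
  closed_subspace V -> V v ->
  (forall y, V y -> hnorm (x - v) <= hnorm (x - y)) ->
  forall y, V y -> '[< x - v, y >] = 0.
Proof.
move=> Vc Vv vmin.
(* The quadratic t |-> |x - v + t y|^2 is minimal at 0. *)
have key y : V y -> rdot (x - v) y = 0.
  move=> Vy; set r := rdot _ _; set s := hnorm y ^+ 2.
  have q t : 0 <= 2 * t * r + t ^+ 2 * s.
    have : hnorm (x - v) <= hnorm ((x - v) + t%:C *: y).
      rewrite (_ : x - v + t%:C *: y = x - (v - t%:C *: y)) ?vmin //.
        by apply: subspaceB => //; apply: subspaceZ.
      by rewrite opprB addrA addrAC.
    rewrite -(@ler_pXn2r _ 2) ?nnegrE ?hnorm_ge0 //.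
    rewrite [leRHS]hnorm_sqrD rdotZ hnormZ.
    by rewrite modulusR exprMn real_normK ?num_real // -/r -/s; lra.
  have s0 : 0 <= s by rewrite exprn_ge0 ?hnorm_ge0.
  (* The minimum point - r / s, with s + 1 in place of s, which can be 0. *)
  have := q (- r / (s + 1)).
  rewrite (_ : _ + _ = - (r / (s + 1)) ^+ 2 * (s + 2)); last by field; lra.
  rewrite mulNr oppr_ge0 => h.
  have /eqP : (r / (s + 1)) ^+ 2 * (s + 2) = 0.
    by apply/eqP; rewrite eq_le h mulr_ge0 ?sqr_ge0 //; lra.
  rewrite mulf_eq0 sqrf_eq0 mulf_eq0 invr_eq0 => /orP[/orP[/eqP//|]|];
    by move=> /eqP; lra.
move=> y Vy; apply: modulus_eq0; apply/eqP; rewrite -sqrf_eq0; apply/eqP.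
have := key ('[< x - v, y >] *: y) (subspaceZ _ Vc.1 Vy).
by rewrite /rdot dotpZr mulrC mulc_conj.
Qed.

(** A minimizing sequence for the distance to [V] is Cauchy. *)
Theorem projection_exists H (V : set H) (x : H) : closed_subspace V ->
  exists v, V v /\ forall y, V y -> '[< x - v, y >] = 0.
Proof.
move=> Vc; pose S := [set hnorm (x - y) | y in V].
have hS : has_inf S.
  split; first by exists (hnorm (x - 0)), 0 => //; exact: subspace0.
  by exists 0 => _ [y _ <-]; exact: hnorm_ge0.
pose D := inf S.
have Dle y : V y -> D <= hnorm (x - y).
  by move=> Vy; apply: ge_inf; [case: hS | exists y].
have D0 : 0 <= D.
  by apply: lb_le_inf; [case: hS|move=> _ [y _ <-]; exact: hnorm_ge0].
have /choice[u hu] : forall n : nat,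
    exists y, V y /\ hnorm (x - y) < D + n.+1%:R^-1.
  move=> n; have n0 : 0 < n.+1%:R^-1 :> R by rewrite invr_gt0 ltr0n.
  have [_ [y Vy <-] yD] := inf_adherent n0 hS.
  by exists y.
have small (e : R) : 0 < e ->
    exists N, forall n, (N <= n)%N -> (n.+1%:R^-1 : R) < e.
  move=> e0; exists (Num.truncn e^-1) => n Nn.
  rewrite invf_plt ?posrE ?ltr0n //; apply: lt_le_trans (truncnS_gt _) _.
  by rewrite ler_nat ltnS.
have [|v hv] := @hilbert_complete _ _ u.
  move=> e e0.
  (* Two points of V at distance at most D + eps from x are, by the
     parallelogram law, at squared distance at most 8 D eps + 4 eps^2, because
     their midpoint is in V. *)
  have [|N hN] := small (Num.min 1 (e ^+ 2 / (8 * D + 4))).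
    by rewrite lt_min ltr01 divr_gt0 ?exprn_gt0 //; lra.
  exists N => n m /hN en /hN em.
  have [[Vn hn] [Vm hm]] := (hu n, hu m).
  set en' := n.+1%:R^-1 in en hn; set em' := m.+1%:R^-1 in em hm.
  have half : hnorm ((x - u n) + (x - u m)) =
      2 * hnorm (x - (2 : C)^-1 *: (u n + u m)).
    have <- : modulus (2 : C) = 2.
      by rewrite -[2 : C](rmorph_nat (real_complex R)) modulusR normr_nat.
    rewrite -hnormZ; congr hnorm; rewrite scalerBr scalerA divff ?pnatr_eq0 //.
    by rewrite scale1r scaler_nat mulr2n opprD addrACA.
  have Dmid : D <= hnorm (x - (2 : C)^-1 *: (u n + u m)).
    by apply: Dle; apply: subspaceZ => //; apply: subspaceD.
  have par := parallelogram (x - u n) (x - u m).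
  rewrite half (_ : x - u n - _ = u m - u n) in par; last first.
    by rewrite opprB addrC addrA subrK.
  rewrite hnormBC -(@ltr_pXn2r _ 2) ?nnegrE ?hnorm_ge0 ?ltW //.
  have := hnorm_ge0 (x - u n); have := hnorm_ge0 (x - u m).
  have en0 : 0 < en' by rewrite invr_gt0 ltr0n.
  have em0 : 0 < em' by rewrite invr_gt0 ltr0n.
  move: en em; rewrite !lt_min !ltr_pdivlMr ?ltr_wpDl ?mulr_ge0 //.
  move=> /andP[en1 en2] /andP[em1 em2].
  nra.
exists v.
have Vv : V v.
  have [_ /closed_hnormP] := Vc; apply => e e0.
  have [N hN] := hv _ e0; exists (u N); first by case: (hu N).
  by rewrite hnormBC hN.
split => //; apply: min_dist_orthogonal => // y /Dle; apply: le_trans.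
rewrite leNgt; apply/negP => Dlt.
have e2 : 0 < (hnorm (x - v) - D) / 2 by rewrite divr_gt0 ?subr_gt0.
have [N hN] := hv _ e2; have [M hM] := small _ e2.
have := hN _ (leq_maxl N M); have := hM _ (leq_maxr N M).
have [_] := hu (maxn N M).
move: (u _) (_^-1) => u' i h1 h2 h3.
have := hnormD (x - u') (u' - v); rewrite addrA subrK; lra.
Qed.

Lemma dotp_eq0 H (x : H) : (forall y : H, '[< y, x >] = 0) -> x = 0.
Proof. by move=> h; apply/eqP; rewrite -(dnorm_eq0 (@dotp R H)) h. Qed.

Lemma closed_subspace_preimage (H K : hilbert R) (f : {linear H -> K})
    (M : R) (V : set K) :
  (forall x, hnorm (f x) <= M * hnorm x) -> closed_subspace V ->
  closed_subspace (f @^-1` V).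
Proof.
move=> fM Vc; split; first split.
- by rewrite /= linear0; apply: subspace0.
- move=> a x y Vx Vy; rewrite /preimage /= linearP.
  by apply: subspaceD => //; apply: subspaceZ.
- apply/closed_hnormP => x h; have [_ /closed_hnormP Vc'] := Vc.
  apply: Vc' => e e0; pose M' := `|M| + 1.
  have M0 : 0 < M' by rewrite ltr_wpDl.
  have [|y Vy xy] := h (e / M'); first by rewrite divr_gt0.
  exists (f y) => //; rewrite -linearB.
  apply: le_lt_trans (fM _) _; move: xy; rewrite ltr_pdivlMr // => xy.
  have := hnorm_ge0 (x - y); have := ler_norm M; rewrite /M' in xy *; nra.
Qed.

Lemma closed_subspace_functional_ker H (phi : H -> C) (M : R) :
  (forall a x y, phi (a *: x + y) = a * phi x + phi y) ->
  (forall x, modulus (phi x) <= M * hnorm x) ->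
  closed_subspace [set x | phi x = 0].
Proof.
move=> lin bnd; split; first split => /=.
- by have := lin (-1) 0 0; rewrite scaler0 add0r mulN1r addNr.
- by move=> a x y x0 y0; rewrite /= lin x0 y0 mulr0 addr0.
- apply/closed_hnormP => x h /=; apply: modulus_eq0.
  apply/eqP; rewrite eq_le modulus_ge0 andbT leNgt; apply/negP => c0.
  pose M' := `|M| + 1; have M0 : 0 < M' by rewrite ltr_wpDl.
  have [|y /= y0 xy] := h (modulus (phi x) / M'); first by rewrite divr_gt0.
  have := bnd (- 1 *: y + x); rewrite lin y0 mulr0 add0r scaleN1r addrC.
  move: xy; rewrite ltr_pdivlMr // /M' => xy.
  have := hnorm_ge0 (x - y); have := ler_norm M; nra.
Qed.

Lemma closed_subspace_dot_ker H (e : H) :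
  closed_subspace [set x : H | '[< x, e >] = 0].
Proof.
apply: (@closed_subspace_functional_ker _ _ (hnorm e)) => [a x y|x].
  exact: dotpPl.
by rewrite mulrC dotp_le.
Qed.

Lemma closed_subspace_orthocomp H (V : set H) : closed_subspace (orthocomp V).
Proof.
split; first split.
- by move=> y _; exact: linear0l.
- by move=> a x y hx hy z Vz; rewrite dotpPl hx // hy // mulr0 addr0.
- apply/closed_hnormP => x h y Vy.
  have [_ /closed_hnormP] := closed_subspace_dot_ker y; apply => e e0.
  by have [z hz xz] := h e e0; exists z => //; exact: hz.
Qed.

(** The representing vector is a multiple of the component of any vector
    outside the kernel that is orthogonal to the kernel. *)
Theorem riesz H (phi : H -> C) (M : R) :
  (forall a x y, phi (a *: x + y) = a * phi x + phi y) ->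
  (forall x, modulus (phi x) <= M * hnorm x) ->
  exists e : H, forall x, phi x = '[< x, e >].
Proof.
move=> lin bnd.
have phi0 : phi 0 = 0.
  by have := lin (-1) 0 0; rewrite scaler0 add0r mulN1r addNr.
have Kc := closed_subspace_functional_ker lin bnd.
have [all0|] := pselect (forall x, phi x = 0).
  by exists 0 => x; rewrite linear0r.
move=> /existsNP[x0 /eqP x0n0].
have [v [/= v0 vorth]] := projection_exists x0 Kc; set w := x0 - v in vorth.
have phiw : phi w = phi x0.
  by have := lin (-1) v x0; rewrite v0 mulr0 add0r scaleN1r addrC.
have w0 : '[< w, w >] != 0.
  rewrite dnorm_eq0; apply: contraNneq x0n0 => w0.
  by rewrite -phiw w0 phi0.
exists (Num.conj (phi w / '[< w, w >]) *: w) => x.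
rewrite dotpZr conjCK.
have y0 : phi (- (phi x / phi w) *: w + x) = 0.
  by rewrite lin mulNr divfK ?phiw // addNr.
have := dotpPl (- (phi x / phi w)) w x w; rewrite dotpC vorth // conjC0.
move=> /esym/eqP; rewrite mulNr addrC subr_eq0 => /eqP ->.
by field; apply/andP; split; rewrite ?phiw //; exact: w0.
Qed.

Lemma bounded_hnorm (H K : hilbert R) (f : H -> K) (M : R) :
  (forall x, `|f x| <= M%:C * `|x|) -> forall x, hnorm (f x) <= M * hnorm x.
Proof. by move=> fM x; have := fM x; rewrite !hnormE -rmorphM lecR. Qed.

(** By Riesz, the set in which [adjoint] chooses is nonempty. *)
Theorem adjointP (H K : hilbert R) (f : {linear H -> K}) (y : K) :
  bounded_operator f ->
  forall x, '[< f x, y >] = '[< x, adjoint f y >].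
Proof.
move=> [M /bounded_hnorm fM].
have [||e he] := @riesz H (fun x => '[< f x, y >]) (M * hnorm y).
- by move=> a u v; rewrite linearP dotpPl.
- move=> x; apply: le_trans (dotp_le _ _) _; rewrite mulrAC.
  by rewrite ler_wpM2r ?hnorm_ge0.
by rewrite /adjoint; case: xgetP => [z _ //|/(_ e)].
Qed.

Lemma closed_span_sub H (A V : set H) :
  closed_subspace V -> A `<=` V -> closed_span A `<=` V.
Proof. by move=> Vc AV x; apply. Qed.

Lemma sub_closed_span H (A : set H) : A `<=` closed_span A.
Proof. by move=> x Ax V [_]; apply. Qed.

Lemma closed_subspace_span H (A : set H) : closed_subspace (closed_span A).
Proof.
split; first split.
- by move=> V [Vc _]; apply: subspace0.
- move=> a x y hx hy V VA; have [Vc _] := VA.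
  apply: subspaceD (hy _ VA) => //.
  by apply: subspaceZ (hx _ VA).
- apply/closed_hnormP => x h V VA; have [[_ /closed_hnormP Vc] _] := VA.
  by apply: Vc => e /h[y hy xy]; exists y => //; exact: hy.
Qed.

(** Vectors orthogonal to [V] represent the classes of [H / V]: existence is
    [orthocomp_rep], and they have minimal norm in their class, so that their
    norm is the quotient norm. *)
Lemma orthocomp_min H (V : set H) (x z : H) :
  orthocomp V z -> V (x - z) -> hnorm z <= hnorm x.
Proof.
move=> Vz Vxz; rewrite -(@ler_pXn2r _ 2) ?nnegrE ?hnorm_ge0 //.
have -> : x = z + (x - z) by rewrite addrC subrK.
rewrite [leRHS]hnorm_sqrD /rdot (Vz _ Vxz) /= mulr0 addr0 lerDl.
by rewrite exprn_ge0 ?hnorm_ge0.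
Qed.

Lemma orthocomp_rep H (V : set H) (x : H) : closed_subspace V ->
  exists z, orthocomp V z /\ V (x - z).
Proof.
move=> Vc; have [v [Vv hv]] := projection_exists x Vc.
by exists (x - v); split => //; rewrite opprB addrC subrK.
Qed.

Lemma bi_orthocomp H (V : set H) (x : H) : closed_subspace V ->
  orthocomp (orthocomp V) x -> V x.
Proof.
move=> Vc h; have [z [Vz Vxz]] := orthocomp_rep x Vc.
suff z0 : z = 0 by rewrite z0 subr0 in Vxz.
apply/eqP; rewrite -(dnorm_eq0 (@dotp R H)).
have := h _ Vz; have /eqP := Vz _ Vxz.
rewrite linearBr /= subr_eq0 => /eqP <-; rewrite dotpC => /eqP.
by rewrite conjC_eq0 => /eqP ->.
Qed.

(** The topological closure, with real radii. Unlike for [closed_span], its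
    elements are approximated by elements of [V] itself. *)
Definition hclosure H (V : set H) : set H :=
  [set x | forall e : R, 0 < e -> exists2 y, V y & hnorm (x - y) < e].

Lemma closed_subspace_hclosure H (V : set H) : linear_subspace V ->
  closed_subspace (hclosure V).
Proof.
move=> Vl; split; first split.
- by move=> e e0; exists 0; [exact: subspace0|rewrite subrr hnorm0].
- move=> a x y hx hy e e0; pose k := modulus a + 1.
  have k0 : 0 < k by rewrite ltr_wpDl ?modulus_ge0.
  have [|x' Vx' xx'] := hx (e / 2 / k); first by rewrite !divr_gt0.
  have [|y' Vy' yy'] := hy (e / 2); first by rewrite divr_gt0.
  exists (a *: x' + y'); first by apply: subspaceD => //; apply: subspaceZ.
  rewrite opprD addrACA -scalerBr; apply: le_lt_trans (hnormD _ _) _.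
  move: xx'; rewrite hnormZ ltr_pdivlMr // /k => xx'.
  have := hnorm_ge0 (x - x'); lra.
- apply/closed_hnormP => x h e e0.
  have e2 : 0 < e / 2 by rewrite divr_gt0.
  have [y /(_ _ e2) [z Vz yz] xy] := h _ e2; exists z => //.
  have := hnormD (x - y) (y - z); rewrite addrA subrK; lra.
Qed.

End Projection.

(** * A maximum principle *)

Section MaximumPrinciple.
Context {R : realType}.
Local Notation C := R[i].
Implicit Types H : hilbert R.

Lemma lipschitz_within (f : R -> R) (a b : R) :
  (forall x y, f x - f y <= `|x - y|) -> {within `[a, b], continuous f}.
Proof.
move=> fL; apply: continuous_subspaceT => x; apply/cvgrPdist_lt => e e0.
near=> y.
have xy : `|x - y| < e by near: y; exact: (@cvgr_dist_lt _ _ _ (nbhs x) _ id x).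
apply: le_lt_trans xy; rewrite ler_norml; apply/andP; split; last exact: fL.
by rewrite lerNl opprB distrC.
Unshelve. all: by end_near.
Qed.

(** A minimum over a large square, obtained by minimizing over the imaginary
    part and then over the real part: the partial minimum is again
    1-Lipschitz. *)
Lemma coercive_lipschitz_min (g : C -> R) (alpha beta : R) : 0 <= beta ->
  (forall l m : C, g l - g m <= modulus (l - m)) ->
  (forall l : C, modulus l <= alpha + beta * g l) ->
  exists l0, forall l, g l0 <= g l.
Proof.
move=> b0 gL gC; pose B := alpha + beta * g 0.
have B0 : 0 <= B := le_trans (modulus_ge0 _) (gC 0).
have BB : - B <= B by lra.
have inB t : (t \in `[- B, B]) = (`|t| <= B) by rewrite in_itv /= ler_norml.
have modx (x x' y : R) : modulus ((x +i* y) - (x' +i* y)) = `|x - x'|.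
  rewrite -modulusR; congr modulus; apply/eqP; rewrite eq_complex /=.
  by rewrite subrr !eqxx.
have mody (x y y' : R) : modulus ((x +i* y) - (x +i* y')) = `|y - y'|.
  rewrite /modulus normc_def /= subrr expr0n add0r sqrtr_sqr //.
have /choice[Y hY] : forall x : R, exists y : R, `|y| <= B /\
    forall y', `|y'| <= B -> g (x +i* y) <= g (x +i* y').
  move=> x; have [|y yB ymin] := @EVT_min _ (fun y => g (x +i* y)) _ _ BB.
    by apply: lipschitz_within => y y'; rewrite -(mody x) gL.
  by exists y; rewrite -inB; split => // y'; rewrite -inB => /ymin.
have [|x0 x0B x0min] := @EVT_min _ (fun x => g (x +i* Y x)) _ _ BB.
  apply: lipschitz_within => x x'.
  have := (hY x).2 _ (hY x').1; have := gL (x +i* Y x') (x' +i* Y x').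
  by rewrite modx; lra.
have sq x y : `|x| <= B -> `|y| <= B -> g (x0 +i* Y x0) <= g (x +i* y).
  by rewrite -inB => /x0min h /(hY x).2; exact: le_trans.
exists (x0 +i* Y x0) => l; have [gl|gl] := lerP (g l) (g 0); last first.
  by apply: le_trans (ltW gl); apply: sq; rewrite normr0.
have lB : modulus l <= B.
  by apply: le_trans (gC l) _; rewrite lerD2l ler_wpM2l.
case: l gl lB => x y _ lB.
have [hx hy] : `|x| <= modulus (x +i* y) /\ `|y| <= modulus (x +i* y).
  rewrite /modulus normc_def /= -!sqrtr_sqr.
  by rewrite !ler_wsqrtr ?lerDl ?lerDr ?sqr_ge0.
by apply: sq; [exact: le_trans hx lB|exact: le_trans hy lB].
Qed.

(** [F] satisfies, modulo the orthogonal complement of [W], the equation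
    [F h = F 0 + h L (F h)], as a resolvent does with [L] the multiplication
    by [F 0]; so [F h = F 0 + h L(F 0) + ... + h^4 L^4 (F h)]. If [|F|] is
    maximal at 0 then [2 Re <F 0, F h - F 0> + |F h - F 0|^2 <= 0]. Summed over
    [h, ih, -h, -ih], the first term is of order [h^4], because the first three
    powers of these four numbers sum to 0, whereas the second one is about
    [4 |h|^2 d^2], where [d] is the norm of the projection of [L (F 0)] to [W].
    Hence [d = 0]. *)
Lemma max_modulus H (W : set H) (L : {linear H -> H}) (F : C -> H) (s : R) :
  closed_subspace W -> (forall x, hnorm (L x) <= s * hnorm x) ->
  (forall h, W (F h)) -> (forall h, hnorm (F h) <= s) -> hnorm (F 0) = s ->
  (forall x, orthocomp W x -> orthocomp W (L x)) ->
  (forall h, orthocomp W (F h - F 0 - h *: L (F h))) ->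
  forall w, W w -> '[< L (F 0), w >] = 0.
Proof.
move=> Wc Lb WF Fs F0s WL Fres.
have FL h n w : W w -> '[< iter n L (F h), w >] =
    '[< iter n L (F 0), w >] + h * '[< iter n.+1 L (F h), w >].
  have iterL m y z : iter m L (y - z - h *: L y) =
      iter m L y - iter m L z - h *: iter m.+1 L y.
    by elim: m => //= m ->; rewrite !linearB linearZ.
  have : orthocomp W (iter n L (F h - F 0 - h *: L (F h))).
    by elim: n => [|n IHn] //=; exact: WL.
  move=> /[apply]; rewrite iterL !dotpBl dotpZl => /eqP.
  by rewrite subr_eq0 subr_eq addrC => /eqP.
have s0 : 0 <= s by rewrite -F0s hnorm_ge0.
have Ln n x : hnorm (iter n L x) <= s ^+ n * hnorm x.
  elim: n => [|n IHn]; first by rewrite mul1r.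
  apply: le_trans (Lb _) _; rewrite exprS -mulrA; exact: ler_wpM2l.
have [G [WG LG]] : exists G, W G /\ forall w, W w -> '[< L (F 0) - G, w >] = 0.
  exact: projection_exists.
have LGE w : W w -> '[< L (F 0), w >] = '[< G, w >].
  by move=> /LG /eqP; rewrite dotpBl subr_eq0 => /eqP.
suff G0 : hnorm G = 0.
  by move=> w /LGE ->; rewrite (hnorm_eq0 G0) linear0l.
set d := hnorm G; have d0 : 0 <= d := hnorm_ge0 _.
have [sz|sn0] := eqVneq s 0.
  have := hnorm_ge0 (L (F 0)); have := Lb (F 0); rewrite sz mul0r => h1 h2.
  have L0 : L (F 0) = 0 by apply: hnorm_eq0; apply/eqP; rewrite eq_le h1 h2.
  apply/eqP; rewrite /d -sqrf_eq0 hnorm_sqr /rdot -(LGE _ WG) L0.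
  by rewrite linear0l.
have sp : 0 < s by rewrite lt_def sn0 s0.
pose D h := F h - F 0.
have WD h : W (D h) by apply: subspaceB.
have Dlow h : modulus h * d - modulus h ^+ 2 * s ^+ 3 <= hnorm (D h).
  pose w := D h - h *: G; have Ww : W w.
    by apply: subspaceB => //; apply: subspaceZ.
  have ww : '[< w, w >] = h ^+ 2 * '[< iter 2 L (F h), w >].
    rewrite {1}/w /D !dotpBl dotpZl -LGE // (FL h 0%N) // (FL h 1%N) //=.
    by ring.
  have wle : hnorm w ^+ 2 <= modulus h ^+ 2 * s ^+ 3 * hnorm w.
    rewrite hnorm_sqr /rdot ww; apply: le_trans (Re_le_modulus _) _.
    rewrite modulusM modulusX -mulrA ler_wpM2l ?exprn_ge0 ?modulus_ge0 //.
    apply: le_trans (dotp_le _ _) _; rewrite ler_wpM2r ?hnorm_ge0 //.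
    apply: le_trans (Ln _ _) _; rewrite (exprSr _ 2) ler_wpM2l ?exprn_ge0 //.
  have {}wle : hnorm w <= modulus h ^+ 2 * s ^+ 3.
    have := hnorm_ge0 w; rewrite le_eqVlt => /predU1P[<-|w0].
      by rewrite mulr_ge0 ?exprn_ge0 ?modulus_ge0.
    by move: wle; rewrite expr2 ler_pM2r.
  have -> : D h = h *: G + w by rewrite /w addrC subrK.
  have := hnormD (h *: G + w) (- w); rewrite addrK hnormN hnormZ -/d; lra.
have Fsq h : 2 * rdot (F 0) (D h) + hnorm (D h) ^+ 2 <= 0.
  have : hnorm (F h) ^+ 2 <= s ^+ 2.
    by rewrite ler_pXn2r ?nnegrE ?hnorm_ge0.
  have -> : F h = F 0 + D h by rewrite /D addrC subrK.
  by rewrite hnorm_sqrD F0s; lra.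
have avg (h : C) : - (4 * modulus h ^+ 4 * s ^+ 6) <=
    rdot (F 0) (D h) + rdot (F 0) (D ('i * h)) + rdot (F 0) (D (- h))
    + rdot (F 0) (D (- ('i * h))).
  have expand k : k ^+ 4 = h ^+ 4 -> exists g : C, modulus g <= s ^+ 6 /\
      '[< D k, F 0 >] = k * '[< L (F 0), F 0 >]
        + k ^+ 2 * '[< iter 2 L (F 0), F 0 >]
        + k ^+ 3 * '[< iter 3 L (F 0), F 0 >] + h ^+ 4 * g.
    move=> kh; exists '[< iter 4 L (F k), F 0 >]; split.
      apply: le_trans (dotp_le _ _) _; rewrite F0s (exprSr _ 5) ler_wpM2r //.
      by apply: le_trans (Ln _ _) _; rewrite (exprSr _ 4) ler_wpM2l ?exprn_ge0.
    rewrite -kh dotpBl (FL k 0%N) // (FL k 1%N) // (FL k 2%N) // (FL k 3%N) //=.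
    by ring.
  have i2 : ('i : C) ^+ 2 = -1 := sqr_i R.
  have powi k : ('i * k) ^+ 4 = k ^+ 4 :> C.
    by rewrite exprMn (exprM _ 2 2) i2 sqrrN expr1n mul1r.
  have powN k : (- k) ^+ 4 = k ^+ 4 :> C by rewrite (exprM _ 2 2) sqrrN -exprM.
  have [g1 [b1 e1]] := expand h erefl.
  have [g2 [b2 e2]] := expand ('i * h) (powi h).
  have [g3 [b3 e3]] := expand (- h) (powN h).
  have [g4 [b4 e4]] := expand (- ('i * h)) (etrans (powN _) (powi h)).
  rewrite !(rdotC (F 0)) /rdot -!ReD e1 e2 e3 e4.
  set c1 := '[< _, _ >]; set c2 := '[< _, _ >]; set c3 := '[< _, _ >].
  rewrite [X in complex.Re X](_ : _ = h ^+ 4 * (g1 + g2 + g3 + g4)); last first.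
    transitivity
      (h ^+ 4 * (g1 + g2 + g3 + g4) + 2 * h ^+ 2 * (1 + 'i ^+ 2) * c2).
      by ring.
    by rewrite i2 subrr mulr0 mul0r addr0.
  rewrite lerNl -ReN; apply: le_trans (Re_le_modulus _) _.
  rewrite modulusN modulusM modulusX [leRHS]mulrAC mulrC.
  rewrite ler_wpM2r ?exprn_ge0 ?modulus_ge0 //.
  have := modulusD (g1 + g2 + g3) g4; have := modulusD (g1 + g2) g3.
  have := modulusD g1 g2; lra.
have [//|dn0] := eqVneq d 0.
have dp : 0 < d by rewrite lt_def dn0.
(* At this radius the squared increments, at least (2/3 t d)^2 each,
   outweigh the error 2 t^4 s^6 = 2/9 (t d)^2 of each point. *)
pose t := d / (3 * s ^+ 3).
have s3 : 0 < s ^+ 3 by rewrite exprn_gt0.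
have t0 : 0 < t by rewrite divr_gt0 ?mulr_gt0.
have ts : t * s ^+ 3 = d / 3 by rewrite /t; field; rewrite gt_eqF.
have modt : modulus t%:C = t by rewrite modulusR gtr0_norm.
have modi (k : C) : modulus ('i * k) = modulus k.
  rewrite modulusM -[RHS]mul1r /modulus normc_def /=.
  by rewrite expr0n expr1n add0r sqrtr1.
have lowsq k : modulus k = t -> (t * (2 * d / 3)) ^+ 2 <= hnorm (D k) ^+ 2.
  move=> kt; have := Dlow k; rewrite kt => h.
  have lhs0 : 0 <= t * (2 * d / 3) by apply: mulr_ge0; [exact: ltW|lra].
  rewrite ler_pXn2r ?nnegrE ?hnorm_ge0 //.
  apply: le_trans h; rewrite (_ : _ - _ = t * (d - t * s ^+ 3)); last by ring.
  by rewrite ts ler_pM2l //; lra.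
have := avg t%:C; rewrite modt.
have := lowsq _ modt; have := Fsq t%:C.
have := lowsq ('i * t%:C); rewrite modi => /(_ modt); have := Fsq ('i * t%:C).
have := lowsq (- t%:C); rewrite modulusN => /(_ modt); have := Fsq (- t%:C).
have := lowsq (- ('i * t%:C)); rewrite modulusN modi => /(_ modt).
have := Fsq (- ('i * t%:C)).
have -> : 4 * t ^+ 4 * s ^+ 6 = 4 * t ^+ 2 * (t * s ^+ 3) ^+ 2 by ring.
rewrite ts; have : 0 < t ^+ 2 * d ^+ 2 by rewrite mulr_gt0 ?exprn_gt0.
rewrite !exprMn; lra.
Qed.

End MaximumPrinciple.

(** * Maximal modular ideals of a special algebra *)

Section SpecialAlgebra.
Context {R : realType} {H : hilbert R} {T : hilbert_tensor H H}.
Context (A : hilbertian_algebra T) (sA : special A).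
Local Notation C := R[i].
Local Notation "x ** y" := (hmul A x y) (at level 40, left associativity).
Local Notation tens := (tens T).
Local Notation comul := (adjoint (mu A)).

Lemma hmul_linear x : linear (hmul A x).
Proof. by move=> a y z; rewrite /hmul linearDr /= linearZr_LR linearP. Qed.

HB.instance Definition _ x :=
  GRing.isLinear.Build C H H *:%R (hmul A x) (hmul_linear x).

Lemma hmulC x y : x ** y = y ** x. Proof. exact: mu_comm. Qed.

Lemma hmulA x y z : x ** (y ** z) = x ** y ** z.
Proof. by rewrite /hmul mu_assoc. Qed.

Lemma hmulBl x y z : (x - y) ** z = x ** z - y ** z.
Proof. by rewrite hmulC linearB /= !(hmulC z). Qed.

Lemma hmulZl a x y : (a *: x) ** y = a *: (x ** y).
Proof. by rewrite hmulC linearZ /= (hmulC y). Qed.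

Lemma dot_comul t x : '[< mu A t, x >] = '[< t, comul x >].
Proof. exact: adjointP (mu_bounded A) t. Qed.

(** This is where the algebra being special enters, together with
    [hmul_character]. *)
Lemma comul_isometry x y : '[< comul x, comul y >] = '[< x, y >].
Proof. by rewrite -dot_comul sA. Qed.

(** [mu] is the adjoint of an isometry. *)
Lemma hnorm_mu t : hnorm (mu A t) <= hnorm t.
Proof.
have h : hnorm (mu A t) ^+ 2 <= hnorm t * hnorm (mu A t).
  rewrite hnorm_sqr /rdot dot_comul; apply: le_trans (rdot_le _ _) _.
  rewrite ler_wpM2l ?hnorm_ge0 // -(@ler_pXn2r _ 2) ?nnegrE ?hnorm_ge0 //.
  by rewrite !hnorm_sqr /rdot comul_isometry.
have := hnorm_ge0 (mu A t); rewrite le_eqVlt => /predU1P[<-|p0].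
  exact: hnorm_ge0.
by move: h; rewrite expr2 ler_pM2r.
Qed.

Lemma hnorm_tens x y : hnorm (tens x y) = hnorm x * hnorm y.
Proof.
apply/eqP; rewrite -(@eqrXn2 _ 2) ?mulr_ge0 ?hnorm_ge0 //.
rewrite exprMn; apply/eqP/complexI.
by rewrite -dotpp dotp_tens !dotpp -rmorphM.
Qed.

Lemma hnorm_hmul x y : hnorm (x ** y) <= hnorm x * hnorm y.
Proof. by rewrite -hnorm_tens; exact: hnorm_mu. Qed.

(** The sum of the Neumann series [q + q^2 + ...], as the limit of the
    iterates of [y |-> q + q y]. *)
Lemma quasi_inverse q : hnorm q < 1 -> exists y, y - q ** y = q.
Proof.
move=> q1; set k := hnorm q in q1; have k0 : 0 <= k := hnorm_ge0 _.
pose u n := iter n (fun y => q + q ** y) 0.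
pose B := k / (1 - k).
have B0 : 0 <= B by rewrite divr_ge0 // subr_ge0 ltW.
have uB n : hnorm (u n) <= B.
  elim: n => [|n IHn]; first by rewrite hnorm0.
  apply: le_trans (hnormD _ _) _.
  apply: le_trans (lerD (lexx _) (hnorm_hmul _ _)) _.
  rewrite -/k; apply: le_trans (lerD (lexx _) (ler_wpM2l k0 IHn)) _.
  rewrite (_ : k + k * B = B) // /B; field; lra.
have ud n p : hnorm (u (n + p)%N - u n) <= k ^+ n * B.
  elim: n => [|n IHn]; first by rewrite mul1r subr0 uB.
  rewrite addSn /= opprD addrACA subrr add0r -linearB.
  apply: le_trans (hnorm_hmul _ _) _; rewrite exprS -mulrA.
  exact: ler_wpM2l.
have small (e : R) : 0 < e -> exists N, forall n, (N <= n)%N -> k ^+ n * B < e.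
  move=> e0.
  have : (fun n => k ^+ n) @ \oo --> 0 by apply: cvg_expr; rewrite ger0_norm.
  have B1 : 0 < B + 1 by rewrite ltr_wpDl.
  move=> /cvgr_dist_lt /(_ (e / (B + 1))) [|N _ hN]; first exact: divr_gt0.
  exists N => n /hN /=; rewrite sub0r normrN ger0_norm ?exprn_ge0 //.
  rewrite ltr_pdivlMr // => h; apply: le_lt_trans h.
  by rewrite ler_wpM2l ?exprn_ge0 // lerDl.
have [|y hy] := @hilbert_complete _ _ u.
  move=> e e0; have [N hN] := small _ e0; exists N => n m.
  wlog nm : n m / (n <= m)%N => [wl Nn Nm|Nn _].
    have /orP[nm|mn] := leq_total n m; first exact: wl.
    by rewrite hnormBC; exact: wl.
  rewrite hnormBC -(subnKC nm); apply: le_lt_trans (ud _ _) _; exact: hN.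
exists y; apply/eqP; rewrite -subr_eq0; apply/eqP/hnorm_eq0/eqP.
rewrite eq_le hnorm_ge0 andbT leNgt; apply/negP => z0.
have [|N hN] := hy (hnorm (y - q ** y - q) / 2); first exact: divr_gt0.
have h0 := hN N (leqnn N); have h1 := hN N.+1 (leqnSn N).
have E : y - q ** y - q = (y - u N.+1) + q ** (u N - y).
  by rewrite /= linearB /= opprD !addrA subrK addrAC.
have := hnormD (y - u N.+1) (q ** (u N - y)); rewrite -E (hnormBC y).
have := hnorm_hmul q (u N - y); rewrite -/k; have := hnorm_ge0 (u N - y); nra.
Qed.

Lemma idealP (I : set H) : is_ideal A I -> linear_subspace I.
Proof. by case. Qed.

Lemma idealM (I : set H) x y : is_ideal A I -> I y -> I (x ** y).
Proof. by case=> _; apply. Qed.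

Lemma idealMr (I : set H) x y : is_ideal A I -> I x -> I (x ** y).
Proof. by rewrite hmulC; exact: idealM. Qed.

(** [x = (x - u x) + u x]. *)
Lemma modular_unit_notin (I : set H) u :
  is_ideal A I -> (forall x, I (x - u ** x)) -> I <> setT -> ~ I u.
Proof.
move=> Ii Iu IT uI; apply: IT; rewrite -subTset => x _.
rewrite -(subrK (u ** x) x); apply: subspaceD (idealP Ii) _ _ => //.
exact: idealMr.
Qed.

(** Otherwise [M] would be dense and contain some [m] with [|u - m| < 1] for
    its modular unit [u]. With [q = u - m] and [y - q y = q] one gets
    [q = (y - u y) + m y] in [M], hence [u] in [M]. *)
Lemma maximal_modular_ideal_closed (M : set H) :
  maximal_modular_ideal A M -> closed_subspace M.
Proof.
move=> [Mi [u Mu] MT Mmax]; have Ml := idealP Mi.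
pose N := hclosure M.
have Nc : closed_subspace N by exact: closed_subspace_hclosure.
have MN : M `<=` N by move=> x Mx e e0; exists x; rewrite // subrr hnorm0.
suff NM : N = M by rewrite -NM.
apply: Mmax => //.
  split=> // x y Ny e e0; pose k := hnorm x + 1.
  have k0 : 0 < k by rewrite ltr_wpDl ?hnorm_ge0.
  have [|z Mz yz] := Ny (e / k); first by rewrite divr_gt0.
  exists (x ** z); first exact: idealM.
  rewrite -linearB; apply: le_lt_trans (hnorm_hmul _ _) _.
  by move: yz; rewrite ltr_pdivlMr // /k; have := hnorm_ge0 (y - z); lra.
move=> NT; have : N u by rewrite NT.
move=> /(_ 1 ltr01)[m Mm]; set q := u - m => q1.
have [y yq] := quasi_inverse q1; apply: (modular_unit_notin Mi Mu MT).
have Mq : M q.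
  rewrite -{}yq /q hmulBl opprB addrA addrAC; apply: subspaceD => //.
  exact: idealMr.
by rewrite -(subrK m u); apply: subspaceD.
Qed.

(** The ideal [M + x H] contains [x = (x - u x) + x u], so it is everything. *)
Lemma maximal_modular_inverse (M : set H) u x :
  maximal_modular_ideal A M -> (forall x, M (x - u ** x)) -> ~ M x ->
  exists y, M (x ** y - u).
Proof.
move=> [Mi _ MT Mmax] Mu Mx; have Ml := idealP Mi.
pose I := [set z | exists m y, M m /\ z = m + x ** y].
have Ii : is_ideal A I.
  split; first split.
  - exists 0, 0; split; first exact: subspace0.
    by rewrite linear0 addr0.
  - move=> a _ _ [m [y [Mm ->]]] [m' [y' [Mm' ->]]].
    exists (a *: m + m'), (a *: y + y'); split; first by case: Ml => _; apply.
    by rewrite linearP /= scalerDr addrACA.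
  - move=> z _ [m [y [Mm ->]]]; exists (z ** m), (z ** y).
    split; first exact: idealM.
    by rewrite linearD /= !hmulA (hmulC z x).
have MI : M `<=` I.
  by move=> m Mm; exists m, 0; split => //; rewrite linear0 addr0.
have Ix : I x by exists (x - u ** x), u; split => //; rewrite (hmulC x) subrK.
have : I u.
  apply: contrapT => Iu; apply: Mx; rewrite -(Mmax I) // => IT.
  by apply: Iu; rewrite IT.
move=> [m [y [Mm ->]]]; exists y.
by rewrite opprD addrCA subrr addr0 -scaleN1r; exact: subspaceZ.
Qed.

(** If [a - l u] is invertible modulo [M] for all [l], its inverse [F l],
    taken orthogonal to [M], satisfies [F l - F m = (l - m) F m F l] modulo
    [M] and contradicts [max_modulus] at a point where [|F|] is maximal. *)
Theorem gelfand_mazur (M : set H) u a :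
  maximal_modular_ideal A M -> (forall x, M (x - u ** x)) ->
  exists l : C, M (a - l *: u).
Proof.
move=> Mm Mu; apply: contrapT => /forallNP ainv.
have Mc := maximal_modular_ideal_closed Mm.
have [Mi _ MT _] := Mm; have uM := modular_unit_notin Mi Mu MT.
have /choice[F hF] : forall l : C, exists y,
    orthocomp M y /\ M ((a - l *: u) ** y - u).
  move=> l; have [z Mz] := maximal_modular_inverse Mm Mu (ainv l).
  have [y [My Mzy]] := orthocomp_rep z Mc; exists y; split => //.
  rewrite -(subrK ((a - l *: u) ** z) (_ ** y)) -linearB -addrA.
  apply: subspaceD => //; apply: idealM => //.
  by rewrite -opprB -scaleN1r; apply: subspaceZ.
have MF l : orthocomp M (F l) by case: (hF l).
pose W := orthocomp M.
have Wc : closed_subspace W by exact: closed_subspace_orthocomp.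
(* Identities modulo M are tested against the vectors orthogonal to M. *)
have MdotE x w : W w -> M x -> '[< x, w >] = 0.
  by move=> Ww Mx; rewrite dotpC Ww // conjC0.
have unit_dot x w : W w -> '[< u ** x, w >] = '[< x, w >].
  move=> Ww; have /eqP := MdotE _ _ Ww (Mu x).
  by rewrite dotpBl subr_eq0 => /eqP.
have res l z w : W w ->
    '[< a ** (z ** F l), w >] = l * '[< z ** F l, w >] + '[< z, w >].
  move=> Ww; have /eqP := MdotE _ _ Ww (idealM z Mi (hF l).2).
  rewrite linearB /= hmulBl hmulZl linearB linearZ /= !dotpBl dotpZl.
  rewrite !hmulA (hmulC z u) (hmulC z a) -!hmulA !unit_dot //.
  by rewrite subr_eq0 subr_eq addrC => /eqP.
have res2 l m w : W w ->
    '[< F l - F m, w >] = (l - m) * '[< F m ** F l, w >].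
  move=> Ww; have := res l (F m) w Ww; rewrite (hmulC (F m)) (res m) //.
  rewrite dotpBl mulrBl => e; apply/eqP.
  by rewrite subr_eq addrAC -e addrAC subrr add0r.
pose f l := hnorm (F l).
have f0 l : 0 < f l.
  rewrite lt_def hnorm_ge0 andbT; apply/eqP => /hnorm_eq0 Fl0.
  have [_] := hF l; rewrite Fl0 linear0 sub0r => Mu'.
  by apply: uM; rewrite -(opprK u) -scaleN1r; apply: subspaceZ.
have fL l m : hnorm (F l - F m) <= modulus (l - m) * (f m * f l).
  have WD : W (F l - F m) by apply: (subspaceB Wc.1); exact: MF.
  apply: (@le_trans _ _ (hnorm ((l - m) *: (F m ** F l)))).
    apply: orthocomp_min WD _; apply: bi_orthocomp => // w Ww.
    by rewrite dotpBl dotpZl res2 // subrr.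
  by rewrite hnormZ ler_wpM2l ?modulus_ge0 ?hnorm_hmul.
(* The estimate fL, divided by f l * f m, says that 1 / f is 1-Lipschitz; the
   equation l F l = a F l - u modulo M gives its growth. *)
have [l0 l0min] : exists l0, forall l, (f l0)^-1 <= (f l)^-1.
  apply: (@coercive_lipschitz_min _ (fun l => (f l)^-1) (hnorm a) (hnorm u)).
  - exact: hnorm_ge0.
  - move=> l m; have [fl fm] := (f0 l, f0 m).
    rewrite -(ler_pM2r (mulr_gt0 fm fl)).
    apply: le_trans (fL l m); rewrite (_ : _ * _ = f m - f l); last first.
      by field; rewrite !gt_eqF.
    have := hnormD (F m - F l) (F l); rewrite subrK hnormBC -!/(f _); lra.
  - move=> l; have fl := f0 l; rewrite -(ler_pM2r fl) mulrDl -mulrA.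
    rewrite mulVf ?gt_eqF // mulr1.
    rewrite /f -hnormZ; apply: (@le_trans _ _ (hnorm (a ** F l - u))).
      apply: orthocomp_min; first exact: (subspaceZ _ Wc.1 (MF l)).
      have [_] := hF l; rewrite hmulBl hmulZl => h.
      apply: bi_orthocomp => // w Ww; have := MdotE _ _ Ww h.
      by rewrite !dotpBl !dotpZl unit_dot // addrAC.
    by apply: le_trans (hnormB _ _) _; rewrite lerD2r hnorm_hmul.
have fmax l : f l <= f l0 by rewrite -lef_pV2 ?posrE.
have FF0 : orthocomp W (F l0 ** F l0).
  have := @max_modulus _ _ W (hmul A (F l0)) (fun h => F (l0 + h)) (f l0) Wc.
  rewrite addr0; apply => //.
  - by move=> x; exact: hnorm_hmul.
  - by move=> h; exact: MF.
  - by move=> h; exact: fmax.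
  - move=> x Wx w Ww; apply: MdotE => //; apply: idealM => //.
    exact: bi_orthocomp.
  - move=> h w Ww; rewrite dotpBl dotpZl res2 //.
    by rewrite addrAC subrr add0r subrr.
(* As a F l0 = l0 F l0 + u modulo M, if the square of F l0 is in M, so is
   F l0. *)
have MFF : M (F l0 ** F l0) by exact: bi_orthocomp.
have FF : '[< F l0, F l0 >] = 0.
  have := res l0 (F l0) _ (MF l0).
  rewrite (MdotE _ _ (MF l0) MFF) (MdotE _ _ (MF l0) (idealM a Mi MFF)).
  by rewrite mulr0 add0r.
have := f0 l0; rewrite /f; have /eqP := FF; rewrite dnorm_eq0 => /eqP ->.
by rewrite hnorm0 ltxx.
Qed.

(** * Character vectors and the radical *)

(** With the maximality of the kernel as part of the definition, the radical is
    orthogonal to every character vector at once. *)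
Definition character_vector (e : H) : Prop :=
  [/\ e <> 0, (forall x y, '[< x ** y, e >] = '[< x, e >] * '[< y, e >]) &
      maximal_modular_ideal A [set x | '[< x, e >] = 0]].

(** The component [p] of the modular unit orthogonal to [M] spans the
    orthogonal complement of [M], which is a line by [gelfand_mazur]; [e] is
    its multiple for which the character takes the value 1 at [u]. *)
Lemma maximal_modular_character (M : set H) : maximal_modular_ideal A M ->
  exists2 e, character_vector e & M = [set x | '[< x, e >] = 0].
Proof.
move=> Mm; have Mc := maximal_modular_ideal_closed Mm.
have [Mi [u Mu] MT _] := Mm.
have [p [Mp Mup]] := orthocomp_rep u Mc.
have p0 : p <> 0.
  by move=> p0; apply: (modular_unit_notin Mi Mu MT); rewrite -(subr0 u) -p0.
have pp : '[< p, p >] != 0 by rewrite dnorm_eq0; apply/eqP.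
pose e := (Num.conj '[< p, p >])^-1 *: p.
have Me x : M x -> '[< x, e >] = 0.
  by move=> Mx; rewrite dotpZr (dotpC x) (Mp _ Mx) conjC0 mulr0.
have ue : '[< u, e >] = 1.
  have /eqP := Me _ Mup; rewrite dotpBl subr_eq0 => /eqP ->.
  by rewrite dotpZr fmorphV /= conjCK mulVf.
have rep x : M (x - '[< x, e >] *: u).
  have [l Ml] := gelfand_mazur x Mm Mu; have := Me _ Ml.
  by rewrite dotpBl dotpZl ue mulr1 => /eqP; rewrite subr_eq0 => /eqP ->.
have ME : M = [set x | '[< x, e >] = 0].
  rewrite eqEsubset; split=> x //=; first exact: Me.
  by move=> xe; have := rep x; rewrite xe scale0r subr0.
exists e => //; split; [|move=> x y|by rewrite -ME].
  by move=> e0; have /eqP := ue; rewrite e0 linear0r eq_sym oner_eq0.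
have := Me _ (idealMr y Mi (rep x)); rewrite hmulBl hmulZl dotpBl dotpZl.
have /eqP := Me _ (Mu y); rewrite dotpBl subr_eq0 => /eqP <- /eqP.
by rewrite subr_eq0 => /eqP.
Qed.

Lemma radicalE : jacobson_radical A = orthocomp character_vector.
Proof.
rewrite eqEsubset; split=> [x Jx e [_ _ /Jx //]|x xE M Mm].
by have [e /xE xe ->] := maximal_modular_character Mm.
Qed.

(** Both sides have the same inner product with [x (x) y], because [e]
    defines a multiplicative functional. *)
Lemma comul_character e : character_vector e -> comul e = tens e e.
Proof.
move=> [_ eM _]; apply/eqP; rewrite -subr_eq0; apply/eqP/dotp_eq0 => t.
suff : closed_span [set z | exists x y, z = tens x y] `<=`
    [set t | '[< t, comul e - tens e e >] = 0].
  by rewrite tens_dense; apply.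
apply: closed_span_sub; first exact: closed_subspace_dot_ker.
by move=> _ [x [y ->]] /=; rewrite linearBr /= -dot_comul dotp_tens eM subrr.
Qed.

Lemma hmul_character e : character_vector e -> e ** e = e.
Proof. by move=> /comul_character ce; rewrite /hmul -ce sA. Qed.

(** The isometry turns [<e, f>] into its own square; a value 1 forces
    [|e - f|^2 = 1 + 1 - 2 = 0]. *)
Lemma dot_character e f : character_vector e -> character_vector f ->
  '[< e, f >] = (e == f)%:R.
Proof.
have idem g h : character_vector g -> character_vector h ->
    '[< g, h >] = 0 \/ '[< g, h >] = 1.
  move=> cg ch; have := comul_isometry g h.
  rewrite !comul_character // dotp_tens => /eqP.
  rewrite -subr_eq0 -[X in _ - X]mulr1 -mulrBr mulf_eq0 subr_eq0.
  by case/orP => /eqP; [left|right].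
have unit g : character_vector g -> '[< g, g >] = 1.
  move=> cg; case: (idem g g cg cg) => // /eqP; rewrite dnorm_eq0 => /eqP g0.
  by case: cg.
move=> ce cf; case: eqVneq => [->|/eqP ef]; first exact: unit.
case: (idem e f ce cf) => // ef1; case: ef; apply/eqP; rewrite -subr_eq0.
rewrite -(dnorm_eq0 (@dotp R H)) dnormB ef1 !unit // conjC1.
by rewrite subrr.
Qed.

(** If [p <> 0], an ideal maximal among those that contain all [x - p x] but
    not [p] is a maximal modular ideal with modular unit [p], because an ideal
    containing both is everything. *)
Lemma radical_idempotent p : p ** p = p -> jacobson_radical A p -> p = 0.
Proof.
move=> pp Jp; apply: contrapT => p0.
pose I0 := [set x | p ** x = 0].
have I0p x : I0 (x - p ** x) by rewrite /I0 /= linearB /= hmulA pp subrr.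
(* Adding I0 makes the union of the empty chain a legal upper bound. *)
pose P I := is_ideal A (I `|` I0) /\ ~ I p.
have [F FP Ftot|I [[Ii Ip] Imax]] := @Zorn_bigcup H P.
  split; last by move=> [X FX Xp]; have [_] := FP _ FX.
  have I0i : is_ideal A I0.
    split; first split.
    - exact: linear0.
    - move=> a x y; rewrite /I0 /= linearP /= => -> ->.
      by rewrite scaler0 addr0.
    - move=> x y; rewrite /I0 /= => y0.
      by rewrite hmulA (hmulC p) -hmulA y0 linear0.
  have up X x : F X -> (X `|` I0) x -> (\bigcup_(X in F) X `|` I0) x.
    by move=> FX [Xx|]; [left; exists X|right].
  split; first split.
  - by right; have [[]] := I0i.
  - move=> a x y [[X FX Xx]|I0x] [[Y FY Yy]|I0y].
    + have [XY|YX] := Ftot _ _ FX FY.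
        have [[[_ h] _] _] := FP _ FY.
        by apply: (up Y) => //; apply: h; left => //; exact: XY.
      have [[[_ h] _] _] := FP _ FX.
      by apply: (up X) => //; apply: h; left => //; exact: YX.
    + have [[[_ h] _] _] := FP _ FX.
      by apply: (up X) => //; apply: h; [left|right].
    + have [[[_ h] _] _] := FP _ FY.
      by apply: (up Y) => //; apply: h; [right|left].
    + by right; have [[_ h] _] := I0i; exact: h.
  - move=> x y [[Y FY Yy]|I0y].
      have [[_ h] _] := FP _ FY.
      by apply: (up Y) => //; apply: h; left.
    by right; have [_ h] := I0i; exact: h.
pose M := I `|` I0.
have Mp : ~ M p by move=> [//|]; rewrite /I0 /= pp.
apply: (Mp); apply: Jp; split => //.
- by exists p => x; right.
- by move=> MT; case: Mp; rewrite MT.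
- move=> N Ni NT MN.
  have Np : ~ N p.
    apply: modular_unit_notin NT => // x; apply: MN; right; exact: I0p.
  have NI0 : N `|` I0 = N by apply/setUidPl => x xI; apply: MN; right.
  rewrite eqEsubset; split => //; left.
  apply: contrapT => NI; apply: (Imax N); last by split; rewrite ?NI0.
  split; first by move=> x Ix; apply: MN; left.
  by move=> h; apply: NI; exact: h.
Qed.

(** The product is an idempotent of the radical: a character [g] takes the
    value [<e, g> <f, g>] on it, and [g] differs from [e] or from [f]. *)
Lemma hmul_distinct_characters e f :
  character_vector e -> character_vector f -> e <> f -> e ** f = 0.
Proof.
move=> ce cf /eqP ef; apply: radical_idempotent.
  rewrite -hmulA (hmulC f) -(hmulA e f f) (hmul_character cf) hmulA.
  by rewrite (hmul_character ce).
rewrite radicalE => g cg; have [_ gM _] := cg; rewrite gM !dot_character //.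
case: (eqVneq e g) ef => [->|_ _]; last by rewrite mul0r.
by rewrite eq_sym => /negPf ->; rewrite mulr0.
Qed.

Definition character_span : set H := closed_span character_vector.

(** A vector orthogonal to all character vectors is in the radical by
    [radicalE], hence orthogonal to the orthogonal complement of the
    radical. *)
Lemma radical_orthocomp : orthocomp (jacobson_radical A) = character_span.
Proof.
rewrite eqEsubset; split=> [x xJ|]; last first.
  apply: closed_span_sub; first exact: closed_subspace_orthocomp.
  by move=> e ce y; rewrite radicalE => /(_ _ ce) ye; rewrite dotpC ye conjC0.
apply: bi_orthocomp; first exact: closed_subspace_span.
move=> w ws; apply: xJ; rewrite radicalE => e ce; apply: ws.
exact: sub_closed_span.
Qed.

Lemma closed_subspace_radical : closed_subspace (jacobson_radical A).
Proof. by rewrite radicalE; exact: closed_subspace_orthocomp. Qed.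

(** Separate continuity of the tensor product reduces a statement on the
    tensor square of the span to pairs of generators. *)
Lemma character_span_tens (V : set T) : closed_subspace V ->
  (forall e f, character_vector e -> character_vector f -> V (tens e f)) ->
  tensor_square character_span `<=` V.
Proof.
move=> Vc EV; apply: closed_span_sub => // _ [x [y [xE yE ->]]].
have tensl z : closed_subspace [set w | V (tens w z)].
  apply: (@closed_subspace_preimage _ _ _ (applyr tens z) (hnorm z) V) => // w.
  by rewrite /= hnorm_tens mulrC.
have tensr z : closed_subspace [set w | V (tens z w)].
  apply: (@closed_subspace_preimage _ _ _ (tens z) (hnorm z) V) => // w.
  by rewrite hnorm_tens.
apply: (closed_span_sub (tensl y) _ xE) => e ce.
by apply: (closed_span_sub (tensr e) _ yE) => f cf; exact: EV.
Qed.

Lemma comul_linear : linear comul.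
Proof.
move=> a x y; apply/eqP; rewrite -subr_eq0; apply/eqP/dotp_eq0 => t.
by rewrite linearBr /= dotpPr -!dot_comul dotpPr subrr.
Qed.

HB.instance Definition _ :=
  GRing.isLinear.Build C H T *:%R comul comul_linear.

Lemma character_span_subalgebra : closed_subalgebra A character_span.
Proof.
have Ec : closed_subspace character_span by exact: closed_subspace_span.
split=> //; apply: character_span_tens.
  apply: (@closed_subspace_preimage _ _ _ (mu A) 1) => // t.
  by rewrite mul1r hnorm_mu.
move=> e f ce cf; rewrite /preimage /= -/(e ** f).
have [<-|ef] := pselect (e = f).
  by rewrite hmul_character //; exact: sub_closed_span.
by rewrite hmul_distinct_characters //; exact: subspace0.
Qed.

Lemma character_span_subcoalgebra : closed_subcoalgebra A character_span.
Proof.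
have Ec : closed_subspace character_span by exact: closed_subspace_span.
split=> //; apply: closed_span_sub.
  apply: (@closed_subspace_preimage _ _ _ comul 1);
    last exact: closed_subspace_span.
  move=> x; rewrite mul1r -(@ler_pXn2r _ 2) ?nnegrE ?hnorm_ge0 //.
  by rewrite !hnorm_sqr /rdot comul_isometry.
move=> e ce; rewrite /preimage /= comul_character //; apply: sub_closed_span.
by exists e, e; split => //; apply: sub_closed_span.
Qed.

End SpecialAlgebra.

Theorem theorem11 (R : realType) (H : hilbert R) (T : hilbert_tensor H H)
    (A : hilbertian_algebra T) :
  special A ->
  let J := jacobson_radical A in
  [/\ orthogonal_direct_sum J (orthocomp J),
      closed_subalgebra A (orthocomp J) &
      closed_subcoalgebra A (orthocomp J)].
Proof.
move=> sA J; have Jc : closed_subspace J by exact: closed_subspace_radical.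
split; first split => //.
- exact: closed_subspace_orthocomp.
- by move=> v w Jv wJ; rewrite dotpC wJ // conjC0.
- move=> x; have [w [wJ Jxw]] := orthocomp_rep x Jc.
  by exists (x - w), w; split => //; rewrite subrK.
- by rewrite radical_orthocomp //; exact: character_span_subalgebra.
- by rewrite radical_orthocomp //; exact: character_span_subcoalgebra.
Qed.
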